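(* Let $\kappa$ be a field of characteristic zero. Let $u,v\in\kappa[x,y,z]$, let $h$ be a polynomial in two variables over $\kappa$, and consider the polynomial map $H=(u,v,h(u,v)):\kappa^3\to\kappa^3$. Assume that $H(0)=0$, that $h$ has no linear part, and that the three components $u$, $v$, $h(u,v)$ of $H$ are linearly independent over $\kappa$. Put $A=v_xu_z-u_xv_z$ and $B=v_yu_z-u_yv_z$. If the Jacobian matrix $JH$ is nilpotent and $\deg_z(uA)\neq\deg_z(vB)$, then for every $\lambda\in\kappa$ with $\lambda\neq 0$ the polynomial map $\lambda I+H$ is injective and has a polynomial inverse.
   Context: Subscripts denote partial derivatives, $I$ denotes the identity map, and $\deg_z$ denotes the degree in the variable $z$, with $\deg_z 0=-\infty$. ''$h$ has no linear part'' means that $h$ has no monomials of degree one. $JH$ is the $3\times 3$ matrix of partial derivatives of the components of $H$, with entries in $\kappa[x,y,z]$. *)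

(* Defs.v *)
From HB Require Import structures.
From mathcomp Require Import all_boot all_order all_algebra.
From mathcomp Require Export mpoly.

Set Implicit Arguments.
Unset Strict Implicit.
Unset Printing Implicit Defensive.

Import GRing.Theory.
Local Open Scope ring_scope.

Definition xvar : 'I_3 := @Ordinal 3 0 isT.
Definition yvar : 'I_3 := @Ordinal 3 1 isT.
Definition zvar : 'I_3 := @Ordinal 3 2 isT.

Section PolynomialMaps.
Variables (K : fieldType) (n : nat).

(* A polynomial map K^n -> K^n, given by its components. *)
Definition polymap := n.-tuple {mpoly K[n]}.

Definition polymap_eval (F : polymap) (a : 'rV[K]_n) : 'rV[K]_n :=
  \row_i (tnth F i).@[fun j => a 0 j].

Definition polymap_id : polymap := [tuple 'X_i | i < n].

Definition shift_id (lambda : K) (F : polymap) : polymap :=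
  [tuple lambda *: 'X_i + tnth F i | i < n].

(* G after F *)
Definition polymap_comp (G F : polymap) : polymap :=
  [tuple tnth G i \mPo F | i < n].

(* The identities hold between tuples of polynomials, hence also between the
   induced maps on K^n. *)
Definition has_polynomial_inverse (F : polymap) : Prop :=
  exists G : polymap,
    polymap_comp G F = polymap_id /\ polymap_comp F G = polymap_id.

Definition jacobian (F : polymap) : 'M[{mpoly K[n]}]_n :=
  \matrix_(i, j) (tnth F i)^`M(j).

Definition linearly_independent (F : polymap) : Prop :=
  forall c : 'I_n -> K, \sum_(i < n) c i *: tnth F i = 0 -> forall i, c i = 0.

(* None stands for the degree -oo of the zero polynomial. *)
Definition deg_in (i : 'I_n) (p : {mpoly K[n]}) : option nat :=
  if p == 0 then None else Some (\max_(m <- msupp p) m i)%N.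

Definition no_linear_part (p : {mpoly K[n]}) : Prop :=
  forall m : 'X_{1..n}, mdeg m = 1%N -> p@_m = 0.

End PolynomialMaps.

Definition nilpotent_mx (R : nzRingType) (n : nat) (M : 'M[R]_n) : Prop :=
  exists k : nat, M ^+ k = 0.

(* Main.v *)
Require Import Defs.
From HB Require Import structures.
From mathcomp Require Import all_boot all_order all_algebra.
From mathcomp Require Import mpoly ring zify.

Set Implicit Arguments.
Unset Strict Implicit.
Unset Printing Implicit Defensive.

Import GRing.Theory.
Local Open Scope ring_scope.

(** Write P = h_u(u,v), S = h_v(u,v), D1 = dx + P dz and D2 = dy + S dz.  The
    Jacobian of H is the product of the 3 by 2 matrix with rows (1,0), (0,1),
    (P,S) and the 2 by 3 matrix of the gradients of u and v.  Exchanging the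
    factors preserves nilpotency, so the 2 by 2 matrix of the D_a u, D_a v has
    zero trace and determinant: with p = D1 u, q = D2 u, r = D1 v one gets
    D2 v = -p and p^2 = -qr (jacobian_nilpotent_system).

    Put M = u_z A + v_z B.  Then B^2 = -qM, AB = -pM and A^2 = rM.  Suppose that
    u_z and v_z are both nonzero.  The assumption on uA and vB says exactly that
    the two terms of M have different degrees in z, so the degree of M is known,
    and with it those of p, q and r.  Exchanging (x,u) with (y,v) if necessary,
    let vB have the larger degree; then v_x + P v_z = r has smaller degree in z
    than v.  If P involved z, its leading coefficient P1 and the leading
    coefficient c of v would satisfy c_x = -b P1 c, where b is the degree of v;
    this is absurd for degree reasons in x, so P is free of z
    (transport_coef_free).  Since (-B, A, SA - PB) is tangent to the fibres of
    (u,v), this ties A and B to the derivatives of P, and the remaining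
    possibilities contradict the degrees (asymmetric_system_absurd).

    So one of u and v, say u, is free of z.  The same leading coefficient
    argument makes P and S free of z, whence S = 0 and v_z = c is constant.  The
    level curves of u in the (x,y)-plane have slope -tau with tau = p/q, and
    L = dx - tau dy, which kills u, maps tau to c h_uu(u,v), a function of u that
    L kills again.  Hence L is locally nilpotent on all polynomials; it is also
    nilpotent at 1/q.  If a derivation of a domain is nilpotent at a unit and at
    its inverse, it kills the unit (locally_nilpotent_unit); so L q = 0, which
    forces tau to be affine in x (parabolic_level_curves): the level curves are
    translates of one parabola, and
      u = g(y + kappa x^2/2 + t0 x),  v = c z - (kappa x + t0) u,
      h(u,v) = kappa/(2c) u^2
    (planar_normal_form).  For such a map (X,Y,Z) = lambda I + H the polynomial
      lambda^-2 (kappa X^2/2 + lambda t0 X - c Z + lambda Y)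
    recovers the argument of g, hence u, x, y and z in turn
    (normal_form_invertible). *)

(** * Polynomials, derivatives and composition *)

Section Polynomials.
Variable K : fieldType.

Lemma mpoly_ring_ind n (T : {mpoly K[n]} -> Prop) :
  (forall c, T c%:MP) -> (forall i, T 'X_i) ->
  (forall p q, T p -> T q -> T (p + q)) ->
  (forall p q, T p -> T q -> T (p * q)) -> forall p, T p.
Proof.
move=> TC TX TD TM p; have T1 : T 1 by rewrite -mpolyC1.
have T0 : T 0 by rewrite -mpolyC0.
rewrite [p]mpolyE; apply: (big_ind T T0 TD) => m _.
rewrite -mul_mpolyC; apply/TM => //.
rewrite mpolyXE_id; apply: (big_ind T T1 TM) => i _.
by elim: (m i) => [|e IHe]; rewrite ?expr0 // exprS; apply/TM.
Qed.

Lemma mderivXU n (i j : 'I_n) : ('X_i : {mpoly K[n]})^`M(j) = (i == j)%:R.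
Proof.
rewrite mderivX mnm1E; case: eqP => [->|_]; last exact: scale0r.
rewrite scale1r -mpolyX0; congr ('X_[_]); apply/mnmP => k.
by rewrite mnmBE subnn mnm0E.
Qed.

Lemma mderiv_comp n k (t : k.-tuple {mpoly K[n]}) (p : {mpoly K[k]}) m :
  (p \mPo t)^`M(m) = \sum_l (p^`M(l) \mPo t) * (tnth t l)^`M(m).
Proof.
elim/mpoly_ring_ind: p => [c|i|p q IHp IHq|p q IHp IHq].
- by rewrite comp_mpolyC mderivC big1 // => i _; rewrite mderivC comp_mpoly0 mul0r.
- rewrite (bigD1 i) //= big1 => [|j jNi]; last first.
    by rewrite mderivXU eq_sym (negPf jNi) comp_mpoly0 mul0r.
  by rewrite addr0 mderivXU eqxx comp_mpoly1 mul1r comp_mpolyXU -tnth_nth.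
- rewrite comp_mpolyD mderivD IHp IHq -big_split; apply: eq_bigr => i _.
  by rewrite mderivD comp_mpolyD mulrDl.
- rewrite rmorphM mderivM IHp IHq mulr_suml mulr_sumr -big_split.
  apply: eq_bigr => i _; rewrite mderivM comp_mpolyD !rmorphM.
  rewrite -!/(comp_mpoly _ _) /=; ring.
Qed.

End Polynomials.

(** * The degree in one variable *)

(** The polynomial p seen as a univariate polynomial in X_i.  Its coefficients
    stay in the ring of all n variables, although they do not involve X_i, so that
    they can be differentiated and measured in the other variables. *)
HB.lock Definition vpoly (K : fieldType) (n : nat) (i : 'I_n)
    (p : {mpoly K[n]}) : {poly {mpoly K[n]}} :=
  mmap (polyC \o @mpolyC n K) (fun j => if j == i then 'X else ('X_j)%:P) p.

Section VariablePolynomial.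
Variables (K : fieldType) (n : nat).
Implicit Types (p q : {mpoly K[n]}) (i j k : 'I_n).

Lemma vpoly_is_zmod_morphism i : zmod_morphism (@vpoly K n i).
Proof. by move=> p q; rewrite vpoly.unlock rmorphB. Qed.

Lemma vpoly_is_monoid_morphism i : monoid_morphism (@vpoly K n i).
Proof. by rewrite vpoly.unlock; split=> [|p q]; rewrite ?rmorph1 ?rmorphM. Qed.

HB.instance Definition _ i :=
  GRing.isZmodMorphism.Build _ _ (vpoly i) (vpoly_is_zmod_morphism i).
HB.instance Definition _ i :=
  GRing.isMonoidMorphism.Build _ _ (vpoly i) (vpoly_is_monoid_morphism i).

Lemma vpolyC i (c : K) : vpoly i c%:MP = c%:MP%:P.
Proof. by rewrite vpoly.unlock mmapC. Qed.

Lemma vpolyX i (m : 'X_{1..n}) :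
  vpoly i ('X_[m] : {mpoly K[n]}) =
  ('X_[[multinom if j == i then 0 else m j | j < n]])%:P * 'X^(m i).
Proof.
rewrite vpoly.unlock mmapX /mmap1 (bigD1 i) //= eqxx mulrC; congr (_ * _).
rewrite mpolyXE_id rmorph_prod [RHS](bigD1 i) //= mnmE eqxx expr0 rmorph1 mul1r.
by apply: eq_bigr => j /negPf jNi; rewrite mnmE jNi rmorphXn.
Qed.

(** All facts on degrees in X_i reduce to this description of the coefficients:
    m i must vanish because the coefficients of [vpoly i p] are free of X_i. *)
Lemma mcoeff_vpoly i p e (m : 'X_{1..n}) :
  ((vpoly i p)`_e)@_m =
  if m i == 0 then p@_(m + U_(i) *+ e) else 0.
Proof.
elim/mpolyind: p => [|c m' p _ _ IHp].
  by rewrite rmorph0 coef0 !mcoeff0; case: ifP.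
rewrite rmorphD coefD mcoeffD IHp mcoeffD -mul_mpolyC rmorphM /= vpolyC vpolyX.
rewrite mulrA -rmorphM /= coefCM coefXn mulr_natr mcoeffMn !mcoeffCM mcoeffX.
have [mi0|mi0] := eqVneq (m i) 0%N; last first.
  rewrite addr0; case: eqP => [m'E|_]; last by rewrite mulr0 mul0rn.
  by move: mi0; rewrite -m'E mnmE eqxx.
congr (_ + _); rewrite mcoeffX -mulrnAr -mulr_natr -natrM mulnb.
congr (_ * (nat_of_bool _)%:R); apply/andP/eqP => [[/eqP mE /eqP eE]|m'E].
  apply/mnmP => j; rewrite mnmDE mulmnE mnm1E -mE mnmE (eq_sym i).
  by case: eqP => [->|_]; rewrite ?mul0n ?addn0 // mul1n eE.
split; apply/eqP.
  apply/mnmP => j; rewrite mnmE m'E mnmDE mulmnE mnm1E (eq_sym i).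
  by case: eqP => [->|_]; [rewrite mi0 | rewrite mul0n addn0].
by rewrite m'E mnmDE mulmnE mnm1E eqxx mul1n mi0.
Qed.

End VariablePolynomial.

Section VariableDegree.
Variables (K : fieldType) (n : nat).
Implicit Types (p q : {mpoly K[n]}) (i j k : 'I_n).

(** As for univariate polynomials, the size is one more than the degree, and 0 for
    the zero polynomial. *)
Definition vsize i p := size (vpoly i p).

Lemma vpolyXU i j :
  vpoly i ('X_j : {mpoly K[n]}) = if j == i then 'X else ('X_j)%:P.
Proof. by rewrite vpoly.unlock mmapX mmap1U. Qed.

Lemma vpolyK i : cancel (@vpoly K n i) (fun P => P.['X_i]).
Proof.
elim/mpoly_ring_ind => [c|j|p q IHp IHq|p q IHp IHq].
- by rewrite vpolyC hornerC.
- by rewrite vpolyXU; case: eqP => [->|_]; rewrite ?hornerX ?hornerC.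
- by rewrite rmorphD hornerD IHp IHq.
- by rewrite rmorphM hornerM IHp IHq.
Qed.

Lemma vsize_eq0 i p : (vsize i p == 0)%N = (p == 0).
Proof.
by rewrite size_poly_eq0 -(inj_eq (can_inj (vpolyK i)) p 0) rmorph0.
Qed.

Lemma vsize0 i : vsize i 0 = 0%N.
Proof. by apply/eqP; rewrite vsize_eq0. Qed.

Lemma vsize_gt0 i p : (0 < vsize i p)%N = (p != 0).
Proof. by rewrite lt0n vsize_eq0. Qed.

Lemma vsizeM i p q : p != 0 -> q != 0 ->
  vsize i (p * q) = (vsize i p + vsize i q).-1.
Proof.
by move=> p0 q0; rewrite /vsize rmorphM size_mul // -size_poly_eq0 vsize_eq0.
Qed.

Lemma vsizeN i p : vsize i (- p) = vsize i p.
Proof. by rewrite /vsize rmorphN size_polyN. Qed.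

Lemma vsizeD i p q : (vsize i (p + q)%R <= maxn (vsize i p) (vsize i q))%N.
Proof. by rewrite /vsize rmorphD size_polyD. Qed.

Lemma vsizeDl i p q :
  (vsize i q < vsize i p)%N -> vsize i (p + q) = vsize i p.
Proof. by rewrite /vsize rmorphD; apply: size_polyDl. Qed.

Lemma vpoly_mderiv i p : vpoly i p^`M(i) = (vpoly i p)^`().
Proof.
apply/polyP => e; apply/mpolyP => m; rewrite coef_deriv mcoeffMn !mcoeff_vpoly.
case: eqP => [mi0|_]; last by rewrite mul0rn.
rewrite mcoeff_mderiv mnmDE mulmnE mnm1E eqxx mul1n mi0 -addmA.
congr (p@_(_ + _) *+ _); apply/mnmP => j.
by rewrite mnmDE !mulmnE mnm1E mulnS addnC.
Qed.

Lemma vpoly_mderiv_neq i j p :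
  j != i -> vpoly i p^`M(j) = map_poly (mderiv j) (vpoly i p).
Proof.
move=> jNi; apply/polyP => e; apply/mpolyP => m.
rewrite coef_map /= mcoeff_mderiv !mcoeff_vpoly mnmDE mnm1E (negPf jNi) addn0.
case: eqP => [mi0|_]; last by rewrite mul0rn.
rewrite mcoeff_mderiv mnmDE mulmnE mnm1E eq_sym (negPf jNi) mul0n addn0.
by rewrite -!addmA [(U_(i) *+ e + _)%MM]addmC.
Qed.

Lemma vsize_mderiv_neq i j p : j != i -> (vsize i p^`M(j) <= vsize i p)%N.
Proof. by move=> jNi; rewrite /vsize vpoly_mderiv_neq // size_poly. Qed.

Lemma deg_inE i p :
  deg_in i p = if p == 0 then None else Some (vsize i p).-1.
Proof.
rewrite /deg_in; case: eqP => // /eqP p0; congr Some; apply/eqP.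
have sp : (0 < vsize i p)%N by rewrite vsize_gt0.
rewrite eqn_leq; apply/andP; split.
  apply/bigmax_leqP_seq => m; rewrite mcoeff_msupp => pm _.
  rewrite -ltnS prednK // ltnNge; apply: contra pm => le_m.
  pose m0 : 'X_{1..n} := [multinom if j == i then 0%N else m j | j < n].
  have := mcoeff_vpoly i p (m i) m0.
  rewrite nth_default // mcoeff0 mnmE !eqxx => ->.
  apply/eqP; congr (p@_ _); apply/mnmP => j.
  rewrite mnmDE mulmnE mnm1E mnmE (eq_sym i).
  by case: eqP => [->|_]; rewrite ?mul0n ?addn0 // mul1n.
have : lead_coef (vpoly i p) != 0 by rewrite lead_coef_eq0 -size_poly_eq0 vsize_eq0.
rewrite lead_coefE -/(vsize i p) => lc0.
have [m lcm] : exists m, (vpoly i p)`_(vsize i p).-1@_m != 0.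
  have := lc0; rewrite -msupp_eq0; case E: (msupp _) => [|m s] // _.
  by exists m; rewrite -mcoeff_msupp E mem_head.
move: lcm; rewrite mcoeff_vpoly; case: (m i =P 0%N) => [mi0|_]; last by rewrite eqxx.
rewrite -mcoeff_msupp => m_in.
rewrite (bigD1_seq _ m_in) ?msupp_uniq //= leq_max.
by rewrite mnmDE mulmnE mnm1E eqxx mul1n leq_addl.
Qed.

Hypothesis charK0 : [pchar K] =i pred0.

Lemma mpoly_mulrn_eq0 p e : (p *+ e.+1 == 0) = (p == 0).
Proof.
by rewrite -scaler_nat scaler_eq0 (proj1 (pcharf0P K) charK0).
Qed.

Lemma vsize_mderiv i p : vsize i p^`M(i) = (vsize i p).-1.
Proof.
rewrite /vsize vpoly_mderiv; case E: (size (vpoly i p)) => [|[|e]] /=.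
- by move/eqP: E; rewrite size_poly_eq0 => /eqP ->; rewrite deriv0 size_poly0.
- by have /eqP/size_poly1P[c _ ->] := E; rewrite derivC size_poly0.
apply/eqP; rewrite eqn_leq; apply/andP; split.
  by rewrite -ltnS -E lt_size_deriv // -size_poly_eq0 E.
rewrite ltnNge; apply/negP => /leq_sizeP/(_ e (leqnn e))/eqP.
rewrite coef_deriv mpoly_mulrn_eq0 => /eqP c0.
have: lead_coef (vpoly i p) != 0 by rewrite lead_coef_eq0 -size_poly_eq0 E.
by rewrite lead_coefE E c0 eqxx.
Qed.

Lemma vsize_le1 i p : (vsize i p <= 1)%N = (p^`M(i) == 0).
Proof. by rewrite -(vsize_eq0 i) vsize_mderiv; case: vsize => [|[]]. Qed.

(** If P involved X_i, comparing the degrees of the two terms shows that it would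
    have degree one in X_i; the coefficient of the top power of X_i then gives
    c_k = - b P1 c, where c and P1 are the leading coefficients of p and P and b
    is the degree of p.  This is impossible, as differentiation lowers the degree
    of c in X_k while multiplication by P1 does not. *)
Lemma transport_coef_free i k p P :
  k != i -> (1 < vsize i p)%N ->
  (vsize i (p^`M(k) + P * p^`M(i))%R < vsize i p)%N -> P^`M(i) = 0.
Proof.
move=> kNi p1 lt_p; apply/eqP; rewrite -vsize_le1 leqNgt; apply/negP => P1.
have p0 : p != 0 by rewrite -(vsize_gt0 i) (ltn_trans _ p1).
have P0 : P != 0 by rewrite -(vsize_gt0 i) (ltn_trans _ P1).
have dp0 : p^`M(i) != 0 by rewrite -(vsize_gt0 i) vsize_mderiv -subn1 subn_gt0.
have szPp : vsize i (P * p^`M(i)) = (vsize i P + vsize i p).-2.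
  by rewrite vsizeM // vsize_mderiv; lia.
have P2 : vsize i P = 2%N.
  apply/eqP; rewrite eqn_leq P1 andbT leqNgt; apply/negP => P3.
  have le_pk := vsize_mderiv_neq p kNi.
  by move: lt_p; rewrite addrC vsizeDl szPp; lia.
pose c := lead_coef (vpoly i p).
have c0 : c != 0 by rewrite lead_coef_eq0 -size_poly_eq0 vsize_eq0.
have : (vpoly i (p^`M(k) + P * p^`M(i)))`_(vsize i p).-1 = 0.
  rewrite nth_default // -/(vsize _ _) -ltnS prednK //.
  by rewrite vsize_gt0.
rewrite rmorphD rmorphM coefD /= vpoly_mderiv_neq // coef_map /=.
rewrite -lead_coefE -/c.
have -> : (vpoly i P * vpoly i p^`M(i))`_(vsize i p).-1
    = lead_coef (vpoly i P * vpoly i p^`M(i)).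
  by rewrite lead_coefE -rmorphM /= -/(vsize _ _) szPp P2.
rewrite lead_coefM; set lP := lead_coef _.
have -> : lead_coef (vpoly i p^`M(i)) = c *+ (vsize i p).-1.
  rewrite lead_coefE -/(vsize _ _) vsize_mderiv vpoly_mderiv coef_deriv.
  by rewrite /c lead_coefE /vsize; move: p1; rewrite /vsize; case: size => [|[]].
move=> /eqP; rewrite addr_eq0 => /eqP dcE.
have lP0 : lP != 0 by rewrite lead_coef_eq0 -size_poly_eq0 vsize_eq0.
have : (vsize k c^`M(k) < vsize k c)%N.
  by rewrite vsize_mderiv ltn_predL vsize_gt0.
rewrite dcE vsizeN; case E: (vsize i p) p1 => [|[|e]] //= _.
rewrite vsizeM // ?mpoly_mulrn_eq0 // -[c *+ _]mulr_natl vsizeM //; last first.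
  by rewrite mpoly_mulrn_eq0 oner_eq0.
have: (0 < vsize k lP)%N by rewrite vsize_gt0.
have: (0 < vsize k (e.+1%:R : {mpoly K[n]}))%N.
  by rewrite vsize_gt0 mpoly_mulrn_eq0 oner_eq0.
move: (vsize k _) (vsize k lP) (vsize k c) => a b d; lia.
Qed.

End VariableDegree.

(** * Derivations of a fraction field *)

Lemma fraction_quotient (R : idomainType) (f : {fraction R}) :
  exists ab : R * R,
    (ab.2 != 0) && (f == FracField.tofrac ab.1 / FracField.tofrac ab.2).
Proof.
elim/quotW: f => r; exists (\n_r, \d_r); rewrite /= denom_ratioP /=.
have dF : FracField.tofrac \d_r != 0 by rewrite tofrac_eq0 denom_ratioP.
rewrite -(inj_eq (mulIf dF)) divfK //; unlock FracField.tofrac.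
rewrite -[X in X == _]FracField.pi_mul; apply/eqP/eqmodP.
rewrite /= FracField.equivfE /FracField.mulf.
rewrite !numden_Ratio ?mulf_neq0 ?denom_ratioP ?oner_eq0 //.
by rewrite !mulr1 mulrC.
Qed.

Section FractionDerivation.
Variables (R : idomainType) (F : fieldType) (iota : {rmorphism R -> F}).
Hypothesis iota_inj : injective iota.
Hypothesis F_frac : forall f, exists ab : R * R,
  (ab.2 != 0) && (f == iota ab.1 / iota ab.2).

(** The quotient rule, applied to an arbitrary choice of numerator and
    denominator; [frac_derivationE] is the independence of that choice. *)
Definition frac_derivation (D : R -> R) (f : F) : F :=
  let ab := xchoose (F_frac f) in
  (iota (D ab.1) * iota ab.2 - iota ab.1 * iota (D ab.2)) / iota ab.2 ^+ 2.

Lemma iota_eq0 a : (iota a == 0) = (a == 0).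
Proof. by rewrite -(rmorph0 iota) (inj_eq iota_inj). Qed.

Section OneDerivation.
Variable D : R -> R.
Hypothesis DD : {morph D : a b / a + b}.
Hypothesis DM : forall a b, D (a * b) = D a * b + a * D b.
Local Notation frac_derivation := (frac_derivation D).

Lemma frac_derivationE a b : b != 0 ->
  frac_derivation (iota a / iota b) =
  (iota (D a) * iota b - iota a * iota (D b)) / iota b ^+ 2.
Proof.
move=> b0; rewrite /frac_derivation.
have /andP[] := xchooseP (F_frac (iota a / iota b)).
case: (xchoose _) => c d /= d0 /eqP.
have bF : iota b != 0 by rewrite iota_eq0.
have dF : iota d != 0 by rewrite iota_eq0.
move=> E.
have adE : a * d = c * b.
  by apply: iota_inj; rewrite !rmorphM -[iota a](divfK bF) E mulrAC divfK.
have := congr1 D adE; rewrite !DM => /(congr1 iota).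
rewrite !rmorphD !rmorphM => DE.
have aE : iota a = iota c * iota b / iota d.
  by rewrite -rmorphM -adE rmorphM mulfK.
rewrite aE in DE *.
have -> : iota (D a) = (iota (D c) * iota b + iota c * iota (D b)
    - iota c * iota b / iota d * iota (D d)) / iota d.
  by rewrite -DE addrK mulfK.
by field; rewrite bF dF.
Qed.

Lemma frac_derivation_iota a : frac_derivation (iota a) = iota (D a).
Proof.
have D1 : D 1 = 0.
  by apply: (addrI (D 1)); rewrite addr0 -{3}[1]mulr1 DM mulr1 mul1r.
rewrite -[iota a]divr1 -(rmorph1 iota) frac_derivationE ?oner_neq0 // D1.
by rewrite rmorph0 mulr0 subr0 rmorph1 mulr1 expr1n divr1.
Qed.

Lemma frac_derivationD : {morph frac_derivation : f g / f + g}.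
Proof.
move=> f g.
have [[a b] /= /andP[b0 /eqP ->]] := F_frac f.
have [[c d] /= /andP[d0 /eqP ->]] := F_frac g.
have bF : iota b != 0 by rewrite iota_eq0.
have dF : iota d != 0 by rewrite iota_eq0.
have -> : iota a / iota b + iota c / iota d = iota (a * d + c * b) / iota (b * d).
  by rewrite rmorphD !rmorphM; field; rewrite bF dF.
rewrite !frac_derivationE ?mulf_neq0 // DD !DM !(rmorphD, rmorphM) /=.
by field; rewrite bF dF.
Qed.

Lemma frac_derivationM f g :
  frac_derivation (f * g) = frac_derivation f * g + f * frac_derivation g.
Proof.
have [[a b] /= /andP[b0 /eqP ->]] := F_frac f.
have [[c d] /= /andP[d0 /eqP ->]] := F_frac g.
have bF : iota b != 0 by rewrite iota_eq0.
have dF : iota d != 0 by rewrite iota_eq0.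
have -> : iota a / iota b * (iota c / iota d) = iota (a * c) / iota (b * d).
  by rewrite !rmorphM; field; rewrite bF dF.
rewrite !frac_derivationE ?mulf_neq0 // !DM !(rmorphD, rmorphM) /=.
by field; rewrite bF dF.
Qed.

End OneDerivation.

Lemma frac_derivationC (D E : R -> R) :
  {morph D : a b / a + b} -> (forall a b, D (a * b) = D a * b + a * D b) ->
  {morph E : a b / a + b} -> (forall a b, E (a * b) = E a * b + a * E b) ->
  (forall a, D (E a) = E (D a)) ->
  forall f, frac_derivation D (frac_derivation E f) =
            frac_derivation E (frac_derivation D f).
Proof.
move=> DD DM ED EM DE f.
have [[a b] /= /andP[b0 /eqP ->]] := F_frac f.
have bF : iota b != 0 by rewrite iota_eq0.
have key D' : (forall a b, D' (a * b) = D' a * b + a * D' b) ->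
  frac_derivation D' (iota a / iota b) =
  iota (D' a * b - a * D' b) / iota (b ^+ 2).
  by move=> DM'; rewrite frac_derivationE // rmorphB !rmorphM expr2.
have B (T : R -> R) : {morph T : a b / a + b} -> {morph T : a b / a - b}.
  move=> TD x y; apply: (addIr (T y)).
  by rewrite -TD !subrK.
rewrite !key // !frac_derivationE ?expf_neq0 // !B // !DM !EM !DE.
rewrite !(rmorphD, rmorphM, rmorphXn, rmorphN, rmorphB) /=.
by field.
Qed.

End FractionDerivation.

(** * Locally nilpotent derivations *)

Section LocallyNilpotent.
Variables (R : idomainType) (D : R -> R).
Hypothesis R0 : forall e, (e.+1%:R : R) != 0.
Hypothesis DD : {morph D : a b / a + b}.
Hypothesis DM : forall a b, D (a * b) = D a * b + a * D b.

Definition locally_nilpotent_at f := exists e, iter e D f = 0.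

Lemma derivation0 : D 0 = 0.
Proof. by apply: (addrI (D 0)); rewrite -DD !addr0. Qed.

Lemma derivation1 : D 1 = 0.
Proof. by apply: (addrI (D 1)); rewrite addr0 -{3}[1]mulr1 DM mulr1 mul1r. Qed.

Lemma iter_derivation0 e : iter e D 0 = 0.
Proof. by elim: e => //= e ->; apply: derivation0. Qed.

Lemma iter_derivationD e : {morph iter e D : f g / f + g}.
Proof. by move=> f g; elim: e => //= e ->; rewrite DD. Qed.

Lemma iter_derivation_le d e f : (d <= e)%N -> iter d D f = 0 -> iter e D f = 0.
Proof.
by move=> le_de; rewrite -(subnK le_de) iterD => ->; apply: iter_derivation0.
Qed.

Lemma locally_nilpotent_const f : D f = 0 -> locally_nilpotent_at f.
Proof. by exists 1%N. Qed.

Lemma locally_nilpotent_derive f :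
  locally_nilpotent_at (D f) -> locally_nilpotent_at f.
Proof. by case=> e De; exists e.+1; rewrite iterSr. Qed.

Lemma locally_nilpotentD f g :
  locally_nilpotent_at f -> locally_nilpotent_at g -> locally_nilpotent_at (f + g).
Proof.
move=> [d Df] [e De]; exists (maxn d e); rewrite iter_derivationD.
rewrite (iter_derivation_le (leq_maxl d e) Df).
by rewrite (iter_derivation_le (leq_maxr d e) De) addr0.
Qed.

(** In Leibniz' formula for D^(d+e) (f g) only the term with d derivatives on f
    and e on g survives. *)
Lemma leibniz_top d e f g :
  iter d.+1 D f = 0 -> iter e.+1 D g = 0 ->
  iter (d + e) D (f * g) = (iter d D f * iter e D g) *+ 'C(d + e, d) /\
  iter (d + e).+1 D (f * g) = 0.
Proof.
have [s] := ubnP (d + e); elim: s => // s IHs in d e f g *.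
rewrite ltnS => le_s Df Dg.
have cst f' g' : D f' = 0 -> forall e', iter e' D (f' * g') = f' * iter e' D g'.
  by move=> Df' e'; elim: e' => //= e' ->; rewrite DM Df' mul0r add0r.
case: d e => [|d] [|e] in le_s Df Dg *.
- by rewrite addn0 bin0 mulr1n (cst f g Df 1%N) Dg mulr0.
- by rewrite add0n bin0 mulr1n !cst // Dg mulr0.
- by rewrite addn0 binn mulr1n mulrC [_ * g]mulrC !cst // Df mulr0.
have step c : iter c.+1 D (f * g) = iter c D (D f * g) + iter c D (f * D g).
  by rewrite iterSr DM iter_derivationD.
have [] := IHs d e.+1 (D f) g; rewrite -?iterSr //.
rewrite addnS => E1 E2.
have [] := IHs d.+1 e f (D g); rewrite -?iterSr //; first by rewrite -addnS.
rewrite addSn => E3 E4.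
rewrite addSn addnS !step E1 E2 E3 E4 addr0; split => //.
by rewrite addrC -mulrnDr -binS.
Qed.

Lemma locally_nilpotentM f g :
  locally_nilpotent_at f -> locally_nilpotent_at g -> locally_nilpotent_at (f * g).
Proof.
move=> [d Df] [e De]; exists (d + e).+1.
by have [] := leibniz_top (iter_derivation_le (leqnSn d) Df)
  (iter_derivation_le (leqnSn e) De).
Qed.

Lemma locally_nilpotent_order f : f != 0 -> locally_nilpotent_at f ->
  exists2 d, iter d D f != 0 & iter d.+1 D f = 0.
Proof.
move=> f0 [e De]; have ex : exists e, iter e D f == 0 by exists e; apply/eqP.
case: (ex_minnP ex) => [[|d]] /= /eqP Dd minD; first by rewrite Dd eqxx in f0.
by exists d => //; apply/negP => /minD; rewrite ltnn.
Qed.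

(** If d and e are the orders of f and g, the top derivative of f g is a nonzero
    multiple of the product of two nonzero elements; as f g = 1 is killed by D,
    d + e = 0. *)
Lemma locally_nilpotent_unit f g :
  locally_nilpotent_at f -> locally_nilpotent_at g -> f * g = 1 -> D f = 0.
Proof.
move=> nf ng fg1.
have f0 : f != 0 by apply: contra_eq_neq fg1 => ->; rewrite mul0r eq_sym oner_eq0.
have g0 : g != 0 by apply: contra_eq_neq fg1 => ->; rewrite mulr0 eq_sym oner_eq0.
have [[|d] df Df] := locally_nilpotent_order f0 nf; first exact: Df.
have [e eg Dg] := locally_nilpotent_order g0 ng.
have [/eqP + _] := leibniz_top Df Dg.
rewrite fg1 addSn iterSr derivation1 iter_derivation0 eq_sym -mulr_natr.
have : 'C((d + e).+1, d.+1)%:R != 0 :> R.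
  case E: 'C(_, _) => [|c] //; have := bin_gt0 (d + e).+1 d.+1.
  by rewrite E ltnS leq_addr.
by rewrite !mulf_eq0 (negPf df) (negPf eg) /= => /negPf ->.
Qed.

End LocallyNilpotent.

(** * Constants, and polynomials in two polynomials *)

Lemma cramer2_eq0 (R : idomainType) (a b c d P S : R) :
  b * c - a * d != 0 -> P * a + S * b = 0 -> P * c + S * d = 0 ->
  P = 0 /\ S = 0.
Proof.
move=> det0 E1 E2; split; apply: (mulIf det0); rewrite mul0r.
  by transitivity (b * (P * c + S * d) - d * (P * a + S * b));
    [ring | rewrite E1 E2 !mulr0 subr0].
by transitivity (c * (P * a + S * b) - a * (P * c + S * d));
  [ring | rewrite E1 E2 !mulr0 subr0].
Qed.

Section Constants.
Variable K : fieldType.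
Hypothesis charK0 : [pchar K] =i pred0.

Lemma mderiv_eq0_const n (p : {mpoly K[n]}) :
  (forall i, p^`M(i) = 0) -> p = (p@_0)%:MP.
Proof.
move=> dp; apply/mpolyP => m; rewrite mcoeffC.
have [->|m0] := eqVneq m 0%MM; first by rewrite mulr1.
have /existsP[i mi] : [exists i, m i != 0%N].
  apply: contraR m0; rewrite negb_exists => /forallP m0.
  by apply/eqP/mnmP => i; apply/eqP; rewrite mnm0E; have := m0 i; rewrite negbK.
have := congr1 (mcoeff (m - U_(i))) (dp i).
rewrite mcoeff_mderiv mcoeff0 submK; last first.
  by apply/mnm_lepP => j; rewrite mnm1E; case: eqP => // <-; rewrite lt0n.
move=> /eqP; set c := p@_m; rewrite -[c *+ _]mulr_natr mulf_eq0.
by rewrite (proj1 (pcharf0P K) charK0) orbF => /eqP ->; rewrite mulr0.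
Qed.

Lemma mcoeff0_meval n (p : {mpoly K[n]}) (a : 'I_n -> K) :
  (forall i, a i = 0) -> p.@[a] = p@_0.
Proof.
move=> a0; elim/mpoly_ring_ind: p => [c|i|p q IHp IHq|p q IHp IHq].
- by rewrite mevalC mcoeffC eqxx mulr1.
- by rewrite mevalXU a0 mcoeffX mnm1_eq0.
- by rewrite mevalD IHp IHq mcoeffD.
- by rewrite mevalM IHp IHq rmorphM.
Qed.

Lemma mderiv_comp2 n (h : {mpoly K[2]}) (u v : {mpoly K[n]}) i :
  (h \mPo [tuple u; v])^`M(i) =
  (h^`M(ord0) \mPo [tuple u; v]) * u^`M(i) +
  (h^`M(ord_max) \mPo [tuple u; v]) * v^`M(i).
Proof.
rewrite mderiv_comp big_ord_recl big_ord1 /=; congr (_ + _).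
by congr ((_^`M(_) \mPo _) * _); apply/val_inj.
Qed.

End Constants.

(** * The differential system of a nilpotent Jacobian *)

(** Here w = h(u,v), while P, S stand for the first and Q11, Q12, Q22 for the
    second derivatives of h at (u,v), and i, j, k for x, y, z.  The polynomial h
    enters only through the chain rule, which makes the system symmetric under the
    exchange of (i, u) and (j, v). *)
Record nilpotent_system (K : fieldType) (n : nat) (i j k : 'I_n)
    (u v w P S Q11 Q12 Q22 : {mpoly K[n]}) : Prop := NilpotentSystem {
  sys_vars : forall m, [\/ m = i, m = j | m = k];
  sys_ij : i != j;
  sys_ik : i != k;
  sys_jk : j != k;
  sys_trace : (u^`M(i) + P * u^`M(k)) + (v^`M(j) + S * v^`M(k)) = 0;
  sys_det : (u^`M(i) + P * u^`M(k)) * (v^`M(j) + S * v^`M(k)) =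
            (u^`M(j) + S * u^`M(k)) * (v^`M(i) + P * v^`M(k));
  sys_dw : forall m, w^`M(m) = P * u^`M(m) + S * v^`M(m);
  sys_dP : forall m, P^`M(m) = Q11 * u^`M(m) + Q12 * v^`M(m);
  sys_dS : forall m, S^`M(m) = Q12 * u^`M(m) + Q22 * v^`M(m);
  sys_u0 : u@_0 = 0;
  sys_v0 : v@_0 = 0;
  sys_w0 : w@_0 = 0;
  sys_P0 : P@_0 = 0;
  sys_S0 : S@_0 = 0;
  sys_u_neq0 : u != 0;
  sys_v_neq0 : v != 0;
  sys_w_neq0 : w != 0
}.

Section System.
Variables (K : fieldType) (n : nat).
Hypothesis charK0 : [pchar K] =i pred0.

Lemma nilpotent_system_swap (i j k : 'I_n) (u v w P S Q11 Q12 Q22 : {mpoly K[n]}) :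
  nilpotent_system i j k u v w P S Q11 Q12 Q22 ->
  nilpotent_system j i k v u w S P Q22 Q12 Q11.
Proof.
case=> vars ij ik jk tr det dw dP dS u0 v0 w0 P0 S0 un0 vn0 wn0.
split=> //; try by [rewrite addrC | rewrite eq_sym | move=> m; rewrite addrC].
- by move=> m; case: (vars m) => ->; [apply: Or32 | apply: Or31 | apply: Or33].
- by rewrite mulrC det mulrC.
Qed.

Lemma eq0_of_mderiv (p : {mpoly K[n]}) :
  p@_0 = 0 -> (forall m, p^`M(m) = 0) -> p = 0.
Proof. by move=> p0 /(mderiv_eq0_const charK0) ->; rewrite p0 mpolyC0. Qed.

Variables (i j k : 'I_n) (u v w P S Q11 Q12 Q22 : {mpoly K[n]}).
Hypothesis sys : nilpotent_system i j k u v w P S Q11 Q12 Q22.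

Let A := v^`M(i) * u^`M(k) - u^`M(i) * v^`M(k).
Let B := v^`M(j) * u^`M(k) - u^`M(j) * v^`M(k).
Let p := u^`M(i) + P * u^`M(k).
Let q := u^`M(j) + S * u^`M(k).
Let r := v^`M(i) + P * v^`M(k).
Let M := u^`M(k) * A + v^`M(k) * B.

Let s_opp : v^`M(j) + S * v^`M(k) = - p.
Proof. by have := sys_trace sys; rewrite -/p addrC => /eqP; rewrite addr_eq0 => /eqP. Qed.

Let det_pqr : - (p * p) = q * r.
Proof. by have := sys_det sys; rewrite -/p -/q -/r s_opp mulrN. Qed.

Let AE : A = u^`M(k) * r - v^`M(k) * p. Proof. by rewrite /A /r /p; ring. Qed.
Let BE : B = - (u^`M(k) * p) - v^`M(k) * q.
Proof. by rewrite -mulrN -s_opp /B /q; ring. Qed.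

(* The three identities say that the nilpotent matrix (p q; r -p) is, up to the
   factor M, the rank one matrix built from the vector (A, B). *)
Let sqrB : B * B = - (q * M).
Proof.
apply/eqP; rewrite -subr_eq0; apply/eqP.
transitivity (u^`M(k) ^+ 2 * (p * p + q * r)); last by rewrite -det_pqr subrr mulr0.
by rewrite /M AE BE; ring.
Qed.

Let mulAB : A * B = - (p * M).
Proof.
apply/eqP; rewrite -subr_eq0; apply/eqP.
transitivity (- (u^`M(k) * v^`M(k)) * (p * p + q * r)); last by rewrite -det_pqr subrr mulr0.
by rewrite /M AE BE; ring.
Qed.

Let sqrA : A * A = r * M.
Proof.
apply/eqP; rewrite -subr_eq0; apply/eqP.
transitivity (v^`M(k) ^+ 2 * (p * p + q * r)); last by rewrite -det_pqr subrr mulr0.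
by rewrite /M AE BE; ring.
Qed.

(** The derivation with components -B, A and a suitable third one is the cross
    product of the gradients of u and v, so it kills every function of (u,v). *)
Lemma kernel_derivation (f a b : {mpoly K[n]}) :
  (forall m, f^`M(m) = a * u^`M(m) + b * v^`M(m)) -> f^`M(k) = 0 ->
  A * f^`M(j) = B * f^`M(i).
Proof.
move=> df dfk; apply/eqP; rewrite -subr_eq0; apply/eqP.
transitivity ((u^`M(j) * v^`M(i) - u^`M(i) * v^`M(j)) * f^`M(k)).
  by rewrite !df /A /B; ring.
by rewrite dfk mulr0.
Qed.

(** The hypotheses make the Hessian of h at (u,v) kill (u_k, v_k), so both of
    its rows are proportional to (v_k, -u_k). *)
Lemma hessian_transfer m : P^`M(k) = 0 -> S^`M(k) = 0 ->
  v^`M(k) * S^`M(m) = - (u^`M(k) * P^`M(m)).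
Proof.
move=> Pk Sk; apply/eqP; rewrite -subr_eq0 opprK; apply/eqP.
transitivity (v^`M(m) * S^`M(k) + u^`M(m) * P^`M(k)).
  by rewrite !(sys_dP sys, sys_dS sys); ring.
by rewrite Pk Sk !mulr0 addr0.
Qed.

Lemma system_PS_neq0 : P = 0 -> S = 0 -> False.
Proof.
move=> P0 S0; have /eqP[] := sys_w_neq0 sys.
apply: (eq0_of_mderiv (sys_w0 sys)) => m.
by rewrite (sys_dw sys) P0 S0 !mul0r addr0.
Qed.

Local Notation vs := (vsize k).

Let vs_free (f : {mpoly K[n]}) m : f^`M(k) = 0 -> f^`M(m) != 0 -> vs f^`M(m) = 1%N.
Proof.
move=> fk fm; apply/eqP; rewrite eqn_leq vsize_gt0 fm andbT vsize_le1 //.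
by rewrite mderiv_comm fk mderiv0.
Qed.

Section Asymmetric.
Hypothesis uk : u^`M(k) != 0.
Hypothesis vk : v^`M(k) != 0.
Hypothesis lt_AB : (vs (u * A) < vs (v * B))%N.

Let u1 : (1 < vs u)%N. Proof. by rewrite ltnNge vsize_le1. Qed.
Let v1 : (1 < vs v)%N. Proof. by rewrite ltnNge vsize_le1. Qed.
Let B0 : B != 0.
Proof. by apply: contraTneq lt_AB => ->; rewrite mulr0 vsize0 ltn0. Qed.
Let sB : (0 < vs B)%N. Proof. by rewrite vsize_gt0. Qed.

Let lt_AB' : A != 0 -> (vs u + vs A < vs v + vs B)%N.
Proof.
move=> A0; move: lt_AB; rewrite !vsizeM ?(sys_u_neq0 sys) ?(sys_v_neq0 sys) //.
by lia.
Qed.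

(* No cancellation: the second term of M strictly dominates the first. *)
Let size_M : vs M = (vs v + vs B).-2.
Proof.
have svB : vs (v^`M(k) * B) = (vs v + vs B).-2.
  by rewrite vsizeM // vsize_mderiv //; lia.
rewrite /M addrC vsizeDl // svB.
have [->|A0] := eqVneq A 0; first by rewrite mulr0 vsize0; lia.
have sA : (0 < vs A)%N by rewrite vsize_gt0.
by have := lt_AB' A0; rewrite vsizeM // vsize_mderiv //; lia.
Qed.

Let M0 : M != 0. Proof. by rewrite -(vsize_gt0 k) size_M; lia. Qed.

Let size_minor (m : 'I_n) : m != k ->
  (vs (v^`M(m) * u^`M(k) - u^`M(m) * v^`M(k))%R <= (vs u + vs v).-2)%N.
Proof.
move=> mk; apply: leq_trans (vsizeD _ _ _) _; rewrite vsizeN geq_max.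
have le_um := vsize_mderiv_neq u mk; have le_vm := vsize_mderiv_neq v mk.
apply/andP; split.
  have [->|n0] := eqVneq (v^`M(m)) 0; first by rewrite mul0r vsize0.
  by rewrite vsizeM // vsize_mderiv //; lia.
have [->|n0] := eqVneq (u^`M(m)) 0; first by rewrite mul0r vsize0.
by rewrite vsizeM // vsize_mderiv //; lia.
Qed.

Let size_q : (vs q + vs v = vs B + 2)%N.
Proof.
have q0 : q != 0.
  by apply: contraNneq B0 => q0; rewrite -[_ == 0]orbb -mulf_eq0 sqrB q0 mul0r oppr0.
have := congr1 vs sqrB; rewrite vsizeN !vsizeM // size_M.
by have : (0 < vs q)%N; [rewrite vsize_gt0 | lia].
Qed.

Let size_p : A != 0 -> (vs p + vs v = vs A + 2)%N.
Proof.
move=> A0; have sA : (0 < vs A)%N by rewrite vsize_gt0.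
have p0 : p != 0.
  apply: contraTneq (mulf_neq0 A0 B0) => p0.
  by rewrite mulAB p0 mul0r oppr0 eqxx.
have := congr1 vs mulAB; rewrite vsizeN !vsizeM // size_M.
by have : (0 < vs p)%N; [rewrite vsize_gt0 | lia].
Qed.

Let size_r : A != 0 -> (0 < vs r)%N /\ (vs r + vs v + vs B = vs A + vs A + 2)%N.
Proof.
move=> A0; have sA : (0 < vs A)%N by rewrite vsize_gt0.
have r0 : r != 0.
  by apply: contraNneq A0 => r0; rewrite -[_ == 0]orbb -mulf_eq0 sqrA r0 mul0r.
have := congr1 vs sqrA; rewrite !vsizeM // size_M.
have sr : (0 < vs r)%N by rewrite vsize_gt0.
by split=> //; lia.
Qed.

Let A0_pr : A = 0 -> p = 0 /\ r = 0.
Proof.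
move=> A0; split; apply: (mulIf M0); rewrite mul0r.
  by apply: oppr_inj; rewrite -mulAB A0 mul0r oppr0.
by rewrite -sqrA A0 mul0r.
Qed.

Let lt_r : (vs r < vs v)%N.
Proof.
have [/A0_pr[_ ->]|A0] := eqVneq A 0; first by rewrite vsize0; lia.
have := size_minor (sys_ik sys); rewrite -/A.
have [_ +] := size_r A0; have := lt_AB' A0; lia.
Qed.

Let le_p : (vs p <= vs u)%N.
Proof.
have [/A0_pr[-> _]|A0] := eqVneq A 0; first by rewrite vsize0.
have := size_minor (sys_ik sys); rewrite -/A.
by have := size_p A0; lia.
Qed.

Let le_q : (vs q <= vs u)%N.
Proof.
have := size_minor (sys_jk sys); rewrite -/B.
by have := size_q; lia.
Qed.

Let P_free : P^`M(k) = 0.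
Proof. exact: (transport_coef_free charK0 (sys_ik sys) v1 lt_r). Qed.

Let S_free : (vs p < vs v)%N -> S^`M(k) = 0.
Proof.
move=> lt_p; apply: (transport_coef_free charK0 (sys_jk sys) v1).
by rewrite s_opp vsizeN.
Qed.

(* If P_j and P_i are nonzero, A and B have the same degree, so u has smaller
   degree than v, and [hessian_transfer] equates the degrees of u and v.  If only
   P_j is nonzero then A = 0, and v is killed by both D1 and D2; their
   commutator is (S_i - P_j) d_k, so P_j = S_i, and S_i = 0 by
   [kernel_derivation]. *)
Let Pj0 : P^`M(j) = 0.
Proof.
apply/eqP; apply: contraT => Pj.
have EP := kernel_derivation (sys_dP sys) P_free.
have [Pi|Pi] := eqVneq (P^`M(i)) 0.
  have A0 : A = 0 by apply: (mulIf Pj); rewrite mul0r EP Pi mulr0.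
  have [p0 r0] := A0_pr A0.
  have Sk : S^`M(k) = 0 by apply: S_free; rewrite p0 vsize0; lia.
  have Si : S^`M(i) = 0.
    apply: (mulfI B0); rewrite mulr0.
    by rewrite -(kernel_derivation (sys_dS sys) Sk) A0 mul0r.
  have vkj : v^`M(k)^`M(j) = - (S * v^`M(k)^`M(k)).
    apply/eqP; rewrite -addr_eq0 mderiv_comm; apply/eqP.
    transitivity ((v^`M(j) + S * v^`M(k))^`M(k)).
      by rewrite mderivD mderivM Sk mul0r add0r.
    by rewrite s_opp p0 oppr0 mderiv0.
  have vki : v^`M(k)^`M(i) = - (P * v^`M(k)^`M(k)).
    apply/eqP; rewrite -addr_eq0 mderiv_comm; apply/eqP.
    transitivity (r^`M(k)); last by rewrite r0 mderiv0.
    by rewrite /r mderivD mderivM P_free mul0r add0r.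
  have : r^`M(j) - (v^`M(j) + S * v^`M(k))^`M(i) = 0.
    by rewrite r0 s_opp p0 oppr0 !mderiv0 subr0.
  rewrite /r !mderivD !mderivM Si vkj vki mul0r add0r (mderiv_comm _ _ v).
  rewrite (_ : _ - _ = P^`M(j) * v^`M(k)); last by ring.
  by move/eqP; rewrite mulf_eq0 (negPf Pj) (negPf vk).
have A0 : A != 0.
  apply: contra_neq (mulf_neq0 B0 Pi) => A0.
  by rewrite -EP A0 mul0r.
have sAB : vs A = vs B.
  have := congr1 vs EP; rewrite !vsizeM // (vs_free P_free Pj) (vs_free P_free Pi).
  by have : (0 < vs A)%N; [rewrite vsize_gt0 | lia].
have lt_uv : (vs u < vs v)%N by have := lt_AB' A0; rewrite sAB; lia.
have Sk : S^`M(k) = 0 by apply: S_free; apply: leq_ltn_trans le_p lt_uv.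
have E := hessian_transfer j P_free Sk.
have Sj : S^`M(j) != 0.
  apply: contra_neq (mulf_neq0 uk Pj) => Sj.
  by apply: oppr_inj; rewrite -E Sj mulr0 oppr0.
have := congr1 vs E; rewrite vsizeN !vsizeM // (vs_free P_free Pj) (vs_free Sk Sj).
by rewrite !vsize_mderiv //; lia.
Qed.

(** Once P is constant, it vanishes, and the gradient of w is S times that of v.
    The bound on the degree of q leaves S at most linear in X_k.  Either S does not
    involve X_k and w = 0, or v has degree one, and then the degrees found for
    p, q and r are inconsistent. *)
Lemma asymmetric_system_absurd : False.
Proof.
have Pi0 : P^`M(i) = 0.
  by apply: (mulfI B0); rewrite -(kernel_derivation (sys_dP sys) P_free) Pj0 !mulr0.
have P0 : P = 0.
  by apply: (eq0_of_mderiv (sys_P0 sys)) => m; case: (sys_vars sys m) => ->.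
have [Q11_0 Q12_0] : Q11 = 0 /\ Q12 = 0.
  apply: (@cramer2_eq0 _ (u^`M(j)) (v^`M(j)) (u^`M(k)) (v^`M(k)) _ _ B0).
    by rewrite -(sys_dP sys) P0 mderiv0.
  by rewrite -(sys_dP sys) P0 mderiv0.
have dS m : S^`M(m) = Q22 * v^`M(m) by rewrite (sys_dS sys) Q12_0 mul0r add0r.
have Sk : S^`M(k) != 0.
  apply/negP => /eqP Sk; apply: (system_PS_neq0 P0).
  have Q0 : Q22 = 0 by apply: (mulIf vk); rewrite mul0r -dS.
  by apply: (eq0_of_mderiv (sys_S0 sys)) => m; rewrite dS Q0 mul0r.
have S0 : S != 0 by apply: contraNneq Sk => ->; rewrite mderiv0.
have sS : (vs S <= 2)%N.
  have le_uj := vsize_mderiv_neq u (sys_jk sys).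
  have : (vs (q - u^`M(j))%R <= vs u)%N.
    by apply: leq_trans (vsizeD _ _ _) _; rewrite vsizeN geq_max le_q.
  by rewrite /q addrAC subrr add0r vsizeM // vsize_mderiv //; lia.
have sSk : vs S^`M(k) = 1%N.
  have : (0 < vs S^`M(k))%N by rewrite vsize_gt0.
  by rewrite vsize_mderiv //; lia.
have Q0 : Q22 != 0 by apply: contraNneq Sk => Q0; rewrite dS Q0 mul0r.
have sv : vs v = 2%N.
  have := congr1 vs (dS k); rewrite sSk vsizeM // vsize_mderiv //.
  have : (0 < vs Q22)%N by rewrite vsize_gt0.
  lia.
have sp : (vs v <= vs p)%N by rewrite leqNgt; apply: contra Sk => /S_free ->.
have A0 : A != 0.
  by apply: contraTneq sp => /A0_pr[-> _]; rewrite vsize0 sv.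
have [] := size_r A0.
by have := size_p A0; have := size_q; have := lt_AB' A0; have := le_q; have := lt_r; lia.
Qed.

End Asymmetric.
End System.

(** * Level curves of the slope equation *)

Section Parabolic.
Variables (K : fieldType) (n : nat).
Hypothesis charK0 : [pchar K] =i pred0.
Variables (F : fieldType) (iota : {rmorphism {mpoly K[n]} -> F}).
Hypothesis iota_inj : injective iota.
Hypothesis F_frac : forall f, exists ab : {mpoly K[n]} * {mpoly K[n]},
  (ab.2 != 0) && (f == iota ab.1 / iota ab.2).

Variable D : 'I_n -> F -> F.
Hypothesis D_iota : forall m a, D m (iota a) = iota a^`M(m).
Hypothesis DD : forall m, {morph D m : f g / f + g}.
Hypothesis DM : forall m f g, D m (f * g) = D m f * g + f * D m g.
Hypothesis DC : forall m m' f, D m (D m' f) = D m' (D m f).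

Let D0 m : D m 0 = 0. Proof. by rewrite -(rmorph0 iota) D_iota mderiv0. Qed.
Let DN m f : D m (- f) = - D m f.
Proof. by apply/eqP; rewrite -addr_eq0 -DD addNr D0. Qed.

(** If f b = a then f b_m = a_m for each derivative, so the denominator b can be
    replaced by its derivatives until it becomes constant. *)
Lemma frac_constant (f : F) : (forall m, D m f = 0) -> exists c, f = iota c%:MP.
Proof.
move=> Df; suff IH N (a b : {mpoly K[n]}) :
    (forall m : 'X_{1..n}, (N <= mdeg m)%N -> b@_m = 0) ->
    b != 0 -> iota a = f * iota b -> exists c, f = iota c%:MP.
  have [[a b] /= /andP[b0 /eqP fE]] := F_frac f.
  apply: (IH (msize b) a b) => // [m ?|]; first exact/memN_msupp_eq0/msize_mdeg_ge.
  by rewrite fE divfK // (iota_eq0 iota_inj).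
elim: N => [|N IHN] in a b * => hN b0 E.
  by case/eqP: b0; apply/mpolyP => m; rewrite hN ?mcoeff0.
have dE m : iota a^`M(m) = f * iota b^`M(m).
  by rewrite -D_iota E DM Df mul0r add0r D_iota.
have [/existsP[m bm]|] := boolP [exists m, b^`M(m) != 0].
  apply: (IHN _ _ _ bm (dE m)) => m' le_m'; rewrite mcoeff_mderiv hN ?mul0rn //.
  by rewrite mdegD mdeg1 addn1.
rewrite negb_exists => /forallP db; have {}db m : b^`M(m) = 0.
  by apply/eqP; have := db m; rewrite negbK.
have da m : a^`M(m) = 0 by apply: iota_inj; rewrite dE db rmorph0 mulr0.
have bC := mderiv_eq0_const charK0 db; have aC := mderiv_eq0_const charK0 da.
have bc0 : b@_0 != 0 by apply: contraNneq b0 => b0; rewrite bC b0 mpolyC0.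
exists (a@_0 / b@_0); apply: (mulIf (x := iota b)); first by rewrite (iota_eq0 iota_inj).
by rewrite -E {1}aC {2}bC -rmorphM -mpolyCM divfK.
Qed.

Variables (i j k : 'I_n) (p q kap : {mpoly K[n]}) (tau : F).
Hypothesis vars : forall m, [\/ m = i, m = j | m = k].
Hypotheses (ij : i != j) (ik : i != k) (jk : j != k).
Hypotheses (pk : p^`M(k) = 0) (qk : q^`M(k) = 0) (kapk : kap^`M(k) = 0).
Hypothesis q0 : q != 0.
Hypothesis qE : q^`M(i) = p^`M(j).
Hypothesis pE : iota p = tau * iota q.
Hypothesis tauE : D i tau - tau * D j tau = iota kap.
Hypothesis kapE : iota kap^`M(i) = tau * iota kap^`M(j).

(* The derivation along the level curves of a function whose derivatives in X_i
   and X_j are p and q. *)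
Let L f := D i f - tau * D j f.
Let LD : {morph L : f g / f + g}.
Proof. by move=> f g; rewrite /L !DD; ring. Qed.
Let LM f g : L (f * g) = L f * g + f * L g.
Proof. by rewrite /L !DM; ring. Qed.
Let LDj f : L (D j f) = D j (L f) + D j tau * D j f.
Proof. by rewrite /L DD DN DM [D j (D i f)]DC; ring. Qed.
Let Lkap : L (iota kap) = 0.
Proof. by rewrite /L !D_iota kapE subrr. Qed.
Let Lq : L (iota q) = D j tau * iota q.
Proof. by rewrite /L !D_iota qE -[iota (p^`M(j))]D_iota pE DM D_iota addrK. Qed.

Let natF e : (e.+1%:R : F) != 0.
Proof.
rewrite -(rmorph_nat iota) (iota_eq0 iota_inj) -[_%:R]/(1 *+ e.+1).
by rewrite mpoly_mulrn_eq0 // oner_eq0.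
Qed.

Let ln := locally_nilpotent_at L.
Let lnD := locally_nilpotentD LD.
Let lnM := locally_nilpotentM LD LM.

(* L maps X_i to 1, X_j to -tau, tau to kap and kap to 0. *)
Let ln_iota a : ln (iota a).
Proof.
have LC b : (forall m, b^`M(m) = 0) -> L (iota b) = 0.
  by move=> db; rewrite /L !D_iota !db rmorph0 mulr0 subr0.
have ln_tau : ln tau.
  apply: locally_nilpotent_derive; rewrite /L tauE.
  exact: locally_nilpotent_const.
have ln1 : ln 1.
  apply: locally_nilpotent_const; rewrite -(rmorph1 iota); apply: LC => m.
  by rewrite -mpolyC1 mderivC.
elim/mpoly_ring_ind: a => [b|m|a b Ha Hb|a b Ha Hb].
- by apply: locally_nilpotent_const; apply: LC => m; rewrite mderivC.
- apply: locally_nilpotent_derive; rewrite /L !D_iota !mderivXU.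
  case: (vars m) => ->.
  + by rewrite eqxx (negPf ij) rmorph1 rmorph0 mulr0 subr0.
  + rewrite eqxx eq_sym (negPf ij) rmorph1 rmorph0 mulr1 sub0r.
    rewrite -mulN1r; apply: lnM => //; rewrite -(rmorph1 iota) -rmorphN.
    apply: locally_nilpotent_const; apply: LC => m'.
    by rewrite -mpolyC1 -mpolyCN mderivC.
  + rewrite !(eq_sym k) (negPf ik) (negPf jk) !rmorph0 mulr0 subr0.
    exact: locally_nilpotent_const (derivation0 LD).
- by rewrite rmorphD; apply: lnD.
- by rewrite rmorphM; apply: lnM.
Qed.

(** L (L (1/q)) = - kap_j / q and L kills kap_j / q, so L is nilpotent at 1/q; it
    is also nilpotent at the polynomial q, so L q = tau_j q vanishes.  Then
    L tau_j = kap_j + tau_j^2 gives kap_j = 0. *)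
Lemma parabolic_slope : D j tau = 0 /\ kap^`M(j) = 0.
Proof.
have qF : iota q != 0 by rewrite (iota_eq0 iota_inj).
pose g := (iota q)^-1.
have qg : iota q * g = 1 by rewrite divff.
clearbody g.
have L1 : L 1 = 0 := derivation1 LM.
have Lg : L g = - (D j tau * g).
  apply: (mulfI qF); have := LM (iota q) g; rewrite qg L1 Lq => /esym/eqP.
  rewrite addrC addr_eq0 => /eqP ->.
  by ring.
have LDtau : L (D j tau) = iota kap^`M(j) + D j tau * D j tau.
  by rewrite LDj /L tauE D_iota.
have LDkap : L (iota kap^`M(j)) = D j tau * iota kap^`M(j).
  by rewrite -D_iota LDj Lkap D0 add0r.
have ln_g : ln g.
  apply: locally_nilpotent_derive; apply: locally_nilpotent_derive.
  apply: locally_nilpotent_const.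
  have LN f : L (- f) = - L f.
    by apply/eqP; rewrite -addr_eq0 -LD addNr (derivation0 LD).
  have -> : L (L g) = - (iota kap^`M(j) * g).
    rewrite Lg LN LM LDtau Lg; ring.
  by rewrite LN LM LDkap Lg; ring.
have Dtau : D j tau = 0.
  apply: (mulIf qF); rewrite mul0r -Lq.
  exact: (locally_nilpotent_unit natF LD LM (ln_iota q) ln_g qg).
split=> //; apply: iota_inj; rewrite rmorph0.
by have := LDtau; rewrite Dtau mulr0 addr0 (derivation0 LD).
Qed.

Lemma parabolic_pencil : exists kappa t0 : K,
  kap = kappa%:MP /\ p = (kappa%:MP * 'X_i + t0%:MP) * q.
Proof.
have qF : iota q != 0 by rewrite (iota_eq0 iota_inj).
have [Djtau kapj] := parabolic_slope.
have Ditau : D i tau = iota kap by rewrite -tauE Djtau mulr0 subr0.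
have Dktau : D k tau = 0.
  have := congr1 (D k) pE; rewrite DM !D_iota pk qk rmorph0 mulr0 addr0 => /esym/eqP.
  by rewrite mulf_eq0 (negPf qF) orbF => /eqP.
have kapC : kap = (kap@_0)%:MP.
  apply: (mderiv_eq0_const charK0) => m; case: (vars m) => -> //.
  by apply: iota_inj; rewrite kapE kapj rmorph0 mulr0.
have [|t0 t0E] := @frac_constant (tau - iota ((kap@_0)%:MP * 'X_i)).
  move=> m; rewrite DD DN D_iota mderivM mderivC mul0r add0r mderivXU.
  case: (vars m) => ->; rewrite ?Ditau ?Djtau ?Dktau ?eqxx ?(negPf ij) ?(negPf ik).
  - by rewrite mulr1 -kapC subrr.
  - by rewrite mulr0 rmorph0 subr0.
  - by rewrite mulr0 rmorph0 subr0.
exists kap@_0, t0; split=> //; apply: iota_inj.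
by rewrite rmorphM rmorphD -t0E addrCA subrr addr0.
Qed.

End Parabolic.

(** With tau = p/q and r = - tau^2 q, the hypothesis on p_i + r_j is the
    equation tau_i - tau tau_j = kap. *)
Lemma parabolic_level_curves (K : fieldType) (n : nat) (charK0 : [pchar K] =i pred0)
    (i j k : 'I_n) (p q r kap : {mpoly K[n]}) :
  (forall m, [\/ m = i, m = j | m = k]) -> i != j -> i != k -> j != k ->
  q != 0 -> p^`M(k) = 0 -> q^`M(k) = 0 -> kap^`M(k) = 0 ->
  - (p * p) = q * r -> q^`M(i) = p^`M(j) -> p^`M(i) + r^`M(j) = kap * q ->
  kap^`M(i) * q = p * kap^`M(j) ->
  exists kappa t0 : K,
    kap = kappa%:MP /\ p = (kappa%:MP * 'X_i + t0%:MP) * q.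
Proof.
move=> vars ij ik jk q0 pk qk kapk det qi prE kapE.
suff over_field (F : fieldType) (iota : {rmorphism {mpoly K[n]} -> F}) :
    injective iota -> (forall f, exists ab : {mpoly K[n]} * {mpoly K[n]},
      (ab.2 != 0) && (f == iota ab.1 / iota ab.2)) ->
    exists kappa t0 : K,
      kap = kappa%:MP /\ p = (kappa%:MP * 'X_i + t0%:MP) * q.
  apply: (over_field _ (@FracField.tofrac {mpoly K[n]})).
    by move=> a b /eqP; rewrite tofrac_eq => /eqP.
  exact: fraction_quotient.
move=> iota_inj frac.
have qF : iota q != 0 by rewrite (iota_eq0 iota_inj).
pose tau := iota p / iota q.
have pE : iota p = tau * iota q by rewrite divfK.
clearbody tau.
have rE : iota r = - (tau * tau * iota q).
  apply: (mulfI qF); rewrite -rmorphM -det rmorphN rmorphM pE; ring.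
pose D (m : 'I_n) := frac_derivation frac (mderiv m).
have D_iota m a : D m (iota a) = iota a^`M(m).
  exact: (frac_derivation_iota iota_inj frac (mderivM m)).
have DM m f g : D m (f * g) = D m f * g + f * D m g.
  exact: (frac_derivationM iota_inj frac (mderivM m)).
have DD m : {morph D m : f g / f + g}.
  exact: (frac_derivationD iota_inj frac (mderivD m) (mderivM m)).
have DC m m' f : D m (D m' f) = D m' (D m f).
  apply: (frac_derivationC iota_inj frac (mderivD m) (mderivM m) (mderivD m')).
    exact: mderivM.
  by move=> a; rewrite mderiv_comm.
clearbody D.
have DN m f : D m (- f) = - D m f.
  by apply/eqP; rewrite -addr_eq0 -DD addNr -(rmorph0 iota) D_iota mderiv0.
apply: (@parabolic_pencil _ _ charK0 _ _ iota_inj frac D D_iota DD DM DC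
  i j k p q kap tau) => //.
  apply: (mulIf qF); rewrite -rmorphM -prE rmorphD -!D_iota pE rE.
  rewrite DN !DM D_iota qi -[iota p^`M(j)]D_iota pE DM; ring.
by apply: (mulIf qF); rewrite -rmorphM kapE rmorphM pE mulrAC.
Qed.

(** * The normal form *)

(** Here p = u_i, q = u_j and r = - p^2/q are free of X_k.  Therefore so are P and
    S, then S = 0, and differentiating r with respect to X_k and X_j shows that
    v_k is constant.  The equation v_j = - u_i turns p_i + r_j into c Q11 q, so
    that [parabolic_level_curves] applies with kap = c Q11. *)
Lemma planar_normal_form (K : fieldType) (n : nat) (charK0 : [pchar K] =i pred0)
    (i j k : 'I_n) (u v w P S Q11 Q12 Q22 : {mpoly K[n]}) :
  nilpotent_system i j k u v w P S Q11 Q12 Q22 ->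
  u^`M(k) = 0 -> v^`M(k) != 0 ->
  exists c kappa t0 : K, [/\ c != 0,
    u^`M(i) = (kappa%:MP * 'X_i + t0%:MP) * u^`M(j),
    v = c%:MP * 'X_k - (kappa%:MP * 'X_i + t0%:MP) * u &
    w = (kappa / (2%:R * c))%:MP * u ^+ 2].
Proof.
move=> sys uk vk; have [vars ij ik jk] :=
  And4 (sys_vars sys) (sys_ij sys) (sys_ik sys) (sys_jk sys).
have := sys_trace sys; have := sys_det sys.
rewrite uk !mulr0 !addr0 => det tr.
have sE : v^`M(j) + S * v^`M(k) = - u^`M(i).
  by apply/eqP; rewrite -addr_eq0 addrC tr.
have {tr det} det : - (u^`M(i) * u^`M(i)) =
    u^`M(j) * (v^`M(i) + P * v^`M(k)) by rewrite -det sE mulrN.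
have umk m : u^`M(m)^`M(k) = 0 by rewrite mderiv_comm uk mderiv0.
have q0 : u^`M(j) != 0.
  apply/eqP => q0; have /eqP[] := sys_u_neq0 sys.
  apply: (eq0_of_mderiv charK0 (sys_u0 sys)) => m; case: (vars m) => -> //.
  by apply/eqP; move/eqP: det; rewrite q0 mul0r oppr_eq0 mulf_eq0 orbb.
set r := v^`M(i) + P * v^`M(k) in det.
have rk : r^`M(k) = 0.
  apply: (mulfI q0); rewrite mulr0; have := congr1 (mderiv k) det.
  by rewrite mderivN !mderivM !umk !(mul0r, mulr0, add0r, oppr0).
have v1 : (1 < vsize k v)%N by rewrite ltnNge vsize_le1.
have Sk : S^`M(k) = 0.
  apply: (transport_coef_free charK0 jk v1); apply: leq_ltn_trans v1.
  by rewrite sE vsizeN vsize_le1 // umk.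
have Pk : P^`M(k) = 0.
  apply: (transport_coef_free charK0 ik v1); apply: leq_ltn_trans v1.
  by rewrite vsize_le1 // -/r rk.
have Q12_0 : Q12 = 0.
  by apply: (mulIf vk); move: Pk; rewrite (sys_dP sys) uk mulr0 add0r mul0r.
have Q22_0 : Q22 = 0.
  by apply: (mulIf vk); move: Sk; rewrite (sys_dS sys) uk mulr0 add0r mul0r.
have S0 : S = 0.
  apply: (eq0_of_mderiv charK0 (sys_S0 sys)) => m.
  by rewrite (sys_dS sys) Q12_0 Q22_0 !mul0r addr0.
have dP m : P^`M(m) = Q11 * u^`M(m) by rewrite (sys_dP sys) Q12_0 mul0r addr0.
have Pq : P^`M(j) != 0.
  rewrite dP; apply: mulf_neq0 => //; apply/eqP => Q0.
  apply: (system_PS_neq0 charK0 sys) => //.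
  by apply: (eq0_of_mderiv charK0 (sys_P0 sys)) => m; rewrite dP Q0 mul0r.
have vj : v^`M(j) = - u^`M(i) by rewrite -sE S0 mul0r addr0.
have vkj : v^`M(k)^`M(j) = 0 by rewrite mderiv_comm vj mderivN umk oppr0.
have vik : v^`M(k)^`M(i) = - (P * v^`M(k)^`M(k)).
  apply/eqP; rewrite -addr_eq0 mderiv_comm; apply/eqP; rewrite -[RHS]rk /r.
  by rewrite mderivD mderivM Pk mul0r add0r.
have vkk : v^`M(k)^`M(k) = 0.
  apply: (mulfI Pq); rewrite mulr0; apply: oppr_inj; rewrite oppr0.
  have := congr1 (mderiv j) vik; rewrite mderiv_comm vkj mderiv0 mderivN mderivM.
  by rewrite [_^`M(k)^`M(j)]mderiv_comm vkj mderiv0 mulr0 addr0.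
have vkC : v^`M(k) = (v^`M(k)@_0)%:MP.
  apply: (mderiv_eq0_const charK0) => m; case: (vars m) => -> //.
  by rewrite vik vkk mulr0 oppr0.
set c := v^`M(k)@_0 in vkC.
have c0 : c != 0 by apply: contraNneq vk => c0; rewrite vkC c0 mpolyC0.
have Q11k : Q11^`M(k) = 0.
  apply: (mulIf q0); rewrite mul0r; have := congr1 (mderiv k) (dP j).
  by rewrite mderiv_comm Pk mderiv0 mderivM umk mulr0 addr0.
have dQ : Q11^`M(i) * u^`M(j) = u^`M(i) * Q11^`M(j).
  have := congr1 (mderiv i) (dP j); rewrite mderiv_comm dP !mderivM.
  by rewrite [u^`M(j)^`M(i)]mderiv_comm => /addIr <-; rewrite mulrC.
have [||||kappa [t0 [kapE pE]]] := @parabolic_level_curves K n charK0 i j k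
  (u^`M(i)) (u^`M(j)) r (c%:MP * Q11) vars ij ik jk q0 (umk i) (umk j) _ det.
- by rewrite mderivM mderivC mul0r add0r Q11k mulr0.
- by rewrite mderiv_comm.
- rewrite /r mderivD mderivM dP vkj mulr0 addr0 addrA mderiv_comm vj mderivN.
  by rewrite subrr add0r vkC mulrC mulrA.
- by rewrite !mderivM !mderivC !mul0r !add0r -mulrA dQ mulrCA.
have two0 : (2%:R : K) != 0 by rewrite (proj1 (pcharf0P K) charK0).
have Q11E : Q11 = (kappa / c)%:MP.
  have cMP : c%:MP != 0 :> {mpoly K[n]} by rewrite mpolyC_eq0.
  by apply: (mulfI cMP); rewrite kapE -mpolyCM mulrCA divff ?mulr1.
have PE : P = (kappa / c)%:MP * u.
  apply/eqP; rewrite -subr_eq0; apply/eqP; apply: (eq0_of_mderiv charK0).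
    by rewrite mcoeffB mcoeffCM (sys_P0 sys) (sys_u0 sys) mulr0 subr0.
  move=> m; rewrite mderivB dP Q11E mderivM mderivC mul0r add0r; exact: subrr.
have kapc : (kappa / c)%:MP * c%:MP = kappa%:MP :> {mpoly K[n]}.
  by rewrite -mpolyCM divfK.
exists c, kappa, t0; split=> //; apply/eqP; rewrite -subr_eq0; apply/eqP;
    apply: (eq0_of_mderiv charK0).
- rewrite mcoeffB mcoeffB mcoeffCM mcoeffX mnm1_eq0 mulr0 sub0r (sys_v0 sys).
  by rewrite rmorphM /= (sys_u0 sys) mulr0 oppr0 subr0.
- have rE : r = - ((kappa%:MP * 'X_i + t0%:MP) ^+ 2 * u^`M(j)).
    by apply: (mulfI q0); rewrite -det pE; ring.
  have viE : v^`M(i) = r - kappa%:MP * u.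
    by rewrite /r PE vkC -kapc; ring.
  move=> m; rewrite !(mderivB, mderivM, mderivD, mderivC, mderivXU).
  case: (vars m) => ->.
  + rewrite eqxx eq_sym (negPf ik) viE rE pE /=; ring.
  + rewrite (negPf ij) eq_sym (negPf jk) vj pE /=; ring.
  + rewrite (negPf ik) eqxx vkC uk /=; ring.
- by rewrite mcoeffB mcoeffCM rmorphXn /= (sys_w0 sys) (sys_u0 sys) expr0n mulr0 subr0.
- move=> m; rewrite mderivB (sys_dw sys) S0 mul0r addr0 PE mderivM mderivC.
  have -> : kappa / c = kappa / (2%:R * c) * 2%:R by field; rewrite c0 two0.
  by rewrite mpolyCM mpolyC_nat expr2 mderivM; ring.
Qed.

(** * Inverting the normal form *)

Section Composition.
Variables (K : fieldType) (n : nat).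
Implicit Types (p : {mpoly K[n]}) (F G T : polymap K n).

Lemma comp_mpolyXU_tnth T m : 'X_m \mPo T = tnth T m.
Proof. by rewrite comp_mpolyXU -tnth_nth. Qed.

Lemma comp_mpolyA p F G : (p \mPo G) \mPo F = p \mPo polymap_comp G F.
Proof.
elim/mpoly_ring_ind: p => [c|m|p q IHp IHq|p q IHp IHq].
- by rewrite !comp_mpolyC.
- by rewrite !comp_mpolyXU_tnth tnth_mktuple.
- by rewrite !comp_mpolyD IHp IHq.
- by rewrite !rmorphM /= IHp IHq.
Qed.

Lemma comp_mpoly_agree (charK0 : [pchar K] =i pred0) p F G :
  (forall m, p^`M(m) != 0 -> tnth F m = tnth G m) -> p \mPo F = p \mPo G.
Proof.
move=> agree; rewrite !comp_mpolyEX; apply: eq_big_seq => m m_in.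
congr (_ *: _); rewrite !comp_mpolyX; apply: eq_bigr => i _.
have [->|mi] := eqVneq (m i) 0%N; first by rewrite !expr0.
rewrite agree //; move: m_in; rewrite mcoeff_msupp; apply: contraNneq => dp.
have := congr1 (mcoeff (m - U_(i))) dp; rewrite mcoeff_mderiv mcoeff0 submK.
  set a := p@_m; move/eqP; rewrite -[a *+ _]mulr_natr mulf_eq0.
  by rewrite (proj1 (pcharf0P K) charK0) orbF.
by apply/mnm_lepP => l; rewrite mnm1E; case: eqP => // <-; rewrite lt0n.
Qed.

Lemma polymap_eval_comp G F a :
  polymap_eval (polymap_comp G F) a = polymap_eval G (polymap_eval F a).
Proof.
apply/rowP => m; rewrite !mxE tnth_mktuple comp_mpoly_meval.
by apply: meval_eq => l; rewrite mxE.
Qed.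

Lemma polymap_eval_id a : polymap_eval (polymap_id K n) a = a.
Proof. by apply/rowP => m; rewrite mxE tnth_mktuple mevalXU. Qed.

Variables i j k : 'I_n.
Hypothesis vars : forall m, [\/ m = i, m = j | m = k].
Hypotheses (ij : i != j) (ik : i != k) (jk : j != k).

Definition assign (a b c : {mpoly K[n]}) : polymap K n :=
  [tuple if m == i then a else if m == j then b else c | m < n].

Lemma assign_i a b c : tnth (assign a b c) i = a.
Proof. by rewrite tnth_mktuple eqxx. Qed.
Lemma assign_j a b c : tnth (assign a b c) j = b.
Proof. by rewrite tnth_mktuple eq_sym (negPf ij) eqxx. Qed.
Lemma assign_k a b c : tnth (assign a b c) k = c.
Proof. by rewrite tnth_mktuple !(eq_sym k) (negPf ik) (negPf jk). Qed.

Lemma eq_polymap F G : tnth F i = tnth G i -> tnth F j = tnth G j ->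
  tnth F k = tnth G k -> F = G.
Proof. by move=> Ei Ej Ek; apply: eq_from_tnth => m; case: (vars m) => ->. Qed.

Lemma big_vars (f : 'I_n -> {mpoly K[n]}) : \sum_m f m = f i + f j + f k.
Proof.
rewrite (bigD1 i) // (bigD1 j) ?(eq_sym j) //= (bigD1 k) ?(eq_sym k) ?ik ?jk //=.
rewrite big1 ?addr0 ?addrA // => m /andP[/andP[mi mj] mk].
by case: (vars m) mi mj mk => ->; rewrite eqxx ?andbF.
Qed.

Hypothesis charK0 : [pchar K] =i pred0.

(** The triangular substitution X_j -> X_j - e X_i^2 - t0 X_i turns u into a
    polynomial in X_j alone; setting the other two variables to 0 is then
    harmless. *)
Lemma factors_through_parabolas (u : {mpoly K[n]}) (e t0 : K) :
  u^`M(k) = 0 -> u^`M(i) = (2%:R * e%:MP * 'X_i + t0%:MP) * u^`M(j) ->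
  u = u \mPo assign 0 ('X_j + e%:MP * 'X_i ^+ 2 + t0%:MP * 'X_i) 0.
Proof.
move=> uk ui; set s := (X in assign 0 X 0).
pose T1 := assign 'X_i ('X_j - e%:MP * 'X_i ^+ 2 - t0%:MP * 'X_i) 'X_k.
pose T2 := assign 'X_i s 'X_k.
pose u' := u \mPo T1.
have du' : u'^`M(i) = 0 /\ u'^`M(k) = 0.
  rewrite /u' !mderiv_comp !big_vars !assign_i !assign_j !assign_k uk comp_mpoly0.
  rewrite !mul0r !addr0 ui rmorphM !(rmorphD, rmorphM, rmorph_nat) /=.
  rewrite !comp_mpolyC !comp_mpolyXU_tnth assign_i.
  rewrite !(mderivB, mderivM, mderivC, mderivXU).
  rewrite !eqxx (negPf ik) (negPf jk) [j == i]eq_sym (negPf ij) /=.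
  by split; ring.
have T12 : polymap_comp T1 T2 = polymap_id K n.
  apply: eq_polymap; rewrite !tnth_mktuple ?assign_i ?assign_j ?assign_k.
  - by rewrite eqxx comp_mpolyXU_tnth assign_i.
  - rewrite eq_sym (negPf ij) eqxx !rmorphB !rmorphM /= !comp_mpolyC.
    by rewrite !comp_mpolyXU_tnth assign_i assign_j /s; ring.
  - by rewrite !(eq_sym k) (negPf ik) (negPf jk) comp_mpolyXU_tnth assign_k.
have T13 : polymap_comp T1 (assign 0 s 0) = assign 0 s 0.
  apply: eq_polymap; rewrite /polymap_comp tnth_mktuple /T1 ?assign_i ?assign_j ?assign_k.
  - by rewrite comp_mpolyXU_tnth assign_i.
  - rewrite !rmorphB !rmorphM /= !comp_mpolyC.
    by rewrite !comp_mpolyXU_tnth assign_i assign_j; ring.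
  - by rewrite comp_mpolyXU_tnth assign_k.
transitivity (u' \mPo T2).
  by rewrite /u' comp_mpolyA T12 comp_mpoly_id.
transitivity (u' \mPo assign 0 s 0).
  apply: (comp_mpoly_agree charK0) => m; case: (vars m) => ->.
  - by rewrite (proj1 du') eqxx.
  - by rewrite !assign_j.
  - by rewrite (proj2 du') eqxx.
by rewrite /u' comp_mpolyA T13.
Qed.

Lemma normal_form_invertible (F : polymap K n) (u : {mpoly K[n]})
    (lambda c e d t0 : K) :
  lambda != 0 -> e = c * d -> u^`M(k) = 0 ->
  u^`M(i) = (2%:R * e%:MP * 'X_i + t0%:MP) * u^`M(j) ->
  tnth F i = lambda *: 'X_i + u ->
  tnth F j = lambda *: 'X_j + (c%:MP * 'X_k - (2%:R * e%:MP * 'X_i + t0%:MP) * u) ->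
  tnth F k = lambda *: 'X_k + d%:MP * u ^+ 2 ->
  has_polynomial_inverse F.
Proof.
move=> l0 eE uk ui; rewrite -!mul_mpolyC => Fi Fj Fk.
have uE := factors_through_parabolas uk ui.
pose l : {mpoly K[n]} := lambda%:MP; pose l' : {mpoly K[n]} := lambda^-1%:MP.
have ll : l * l' = 1 by rewrite -mpolyCM divff.
have {}eE : e%:MP = c%:MP * d%:MP :> {mpoly K[n]} by rewrite eE mpolyCM.
pose T a : polymap K n := assign 0 a 0.
have compT a H : polymap_comp (T a) H = T (a \mPo H).
  apply: eq_polymap; rewrite /polymap_comp tnth_mktuple /T.
  - by rewrite !assign_i comp_mpoly0.
  - by rewrite !assign_j.
  - by rewrite !assign_k comp_mpoly0.
pose s := 'X_j + e%:MP * 'X_i ^+ 2 + t0%:MP * 'X_i : {mpoly K[n]}.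
(* [gs] expresses [s] through the components of F: the choice e = c d makes the
   terms in u and u^2 cancel. *)
pose gs := l' ^+ 2 * (e%:MP * 'X_i ^+ 2 + l * t0%:MP * 'X_i - c%:MP * 'X_k + l * 'X_j).
pose U := u \mPo T gs.
pose gi := l' * ('X_i - U).
pose gj := gs - e%:MP * gi ^+ 2 - t0%:MP * gi.
pose gk := l' * ('X_k - d%:MP * U ^+ 2).
exists (assign gi gj gk).
have gsF : gs \mPo F = s.
  rewrite /gs !(rmorphM, rmorphD, rmorphN, rmorphXn) /= !comp_mpolyC.
  rewrite !comp_mpolyXU_tnth Fi Fj Fk -/l.
  transitivity ((l * l') ^+ 2 * s + l' ^+ 2 * (e%:MP - c%:MP * d%:MP) * u ^+ 2).
    by rewrite /s; ring.
  by rewrite ll eE subrr mulr0 mul0r addr0 expr1n mul1r.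
have UF : U \mPo F = u by rewrite /U comp_mpolyA compT gsF -uE.
have giF : gi \mPo F = 'X_i.
  rewrite /gi rmorphM rmorphB /= UF comp_mpolyC comp_mpolyXU_tnth Fi -/l.
  by rewrite addrK mulrA [l' * l]mulrC ll mul1r.
have sG : s \mPo assign gi gj gk = gs.
  rewrite /s !(rmorphM, rmorphD, rmorphXn) /= !comp_mpolyC !comp_mpolyXU_tnth.
  by rewrite assign_i assign_j /gj; ring.
have uG : u \mPo assign gi gj gk = U.
  by rewrite [in LHS]uE comp_mpolyA compT sG.
have Xi : 'X_i = l * gi + U by rewrite /gi mulrA ll mul1r subrK.
have Xk : 'X_k = l * gk + d%:MP * U ^+ 2 by rewrite /gk mulrA ll mul1r subrK.
have Xj : l * 'X_j = l ^+ 2 * gs - e%:MP * 'X_i ^+ 2 - l * t0%:MP * 'X_i + c%:MP * 'X_k.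
  by rewrite /gs mulrA -exprMn ll expr1n mul1r; ring.
have lN0 : l != 0 by rewrite mpolyC_eq0.
have gjE : gj = gs - e%:MP * gi ^+ 2 - t0%:MP * gi by [].
have gkE : gk = l' * ('X_k - d%:MP * U ^+ 2) by [].
clearbody gj gk gi U gs.
split; apply: eq_polymap; rewrite !tnth_mktuple ?assign_i ?assign_j ?assign_k.
- by rewrite eqxx giF.
- rewrite eq_sym (negPf ij) eqxx gjE !(rmorphM, rmorphB, rmorphXn) /= !comp_mpolyC.
  by rewrite gsF giF /s; ring.
- rewrite !(eq_sym k) (negPf ik) (negPf jk) gkE !(rmorphM, rmorphB, rmorphXn) /=.
  rewrite !comp_mpolyC UF comp_mpolyXU_tnth Fk -/l addrK mulrA [l' * l]mulrC ll.
  exact: mul1r.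
- rewrite Fi rmorphD rmorphM /= comp_mpolyC comp_mpolyXU_tnth assign_i uG.
  by rewrite -/l -Xi.
- rewrite Fj !(rmorphD, rmorphN, rmorphM, rmorph_nat) /= !comp_mpolyC.
  rewrite !comp_mpolyXU_tnth assign_i assign_j assign_k uG -/l.
  by apply: (mulfI lN0); rewrite Xj gjE Xi Xk eE; ring.
- rewrite Fk !(rmorphD, rmorphM, rmorphXn) /= !comp_mpolyC comp_mpolyXU_tnth.
  by rewrite assign_k uG -/l -Xk.
Qed.

End Composition.

(** * Nilpotency of the Jacobian *)

Lemma exprS_mulmx_swap (R : nzRingType) (m n : nat) (C : 'M[R]_(m, n))
    (N : 'M[R]_(n, m)) e :
  (N *m C) ^+ e.+1 = N *m (C *m N) ^+ e *m C.
Proof.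
elim: e => [|e IHe]; first by rewrite expr1 expr0 mulmx1.
by rewrite exprS IHe [in RHS]exprS -!mulmxE !mulmxA.
Qed.

(** The determinant is nilpotent, hence zero; then X^2 = tr X . X by
    Cayley-Hamilton, so the trace of a power of X is a power of tr X. *)
Lemma nilpotent_mx2 (R : idomainType) (X : 'M[R]_2) :
  nilpotent_mx X ->
  X ord0 ord0 + X ord_max ord_max = 0 /\
  X ord0 ord0 * X ord_max ord_max = X ord0 ord_max * X ord_max ord0.
Proof.
case=> e Xe.
have dX0 : X ord0 ord0 * X ord_max ord_max - X ord0 ord_max * X ord_max ord0 = 0.
  have detE : \det X = X ord0 ord0 * X ord_max ord_max - X ord0 ord_max * X ord_max ord0.
    rewrite (expand_det_row _ ord0) big_ord_recl big_ord1 /cofactor !det_mx11 !mxE.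
    rewrite expr0 mul1r expr1 mulN1r mulrN.
    by congr (X _ _ * X _ _ - X _ _ * X _ _); apply/val_inj.
  have detX f : \det (X ^+ f) = \det X ^+ f.
    by elim: f => [|f IHf]; rewrite ?expr0 ?det1 // !exprS det_mulmx IHf.
  have : \det X ^+ e = 0 by rewrite -detX Xe det0.
  by rewrite -detE => /eqP; rewrite expf_eq0 => /andP[_ /eqP].
split; last by apply/eqP; rewrite -subr_eq0 dX0.
set t := _ + _.
have XX : X * X = t *: X.
  apply/matrixP => a b; rewrite !mxE big_ord_recl big_ord1.
  have -> : lift ord0 ord0 = ord_max :> 'I_2 by apply/val_inj.
  have split2 (c : 'I_2) : c = ord0 \/ c = ord_max.
    by case: c => [[|[]]] // lt; [left | right]; apply/val_inj.
  apply/eqP; rewrite -subr_eq0; apply/eqP; rewrite /t.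
  case: (split2 a) => ->; case: (split2 b) => ->; try ring;
    by rewrite -[RHS]oppr0 -dX0; ring.
have Xpow f : X ^+ f.+1 = t ^+ f *: X.
  by elim: f => [|f IHf]; rewrite ?expr1 ?expr0 ?scale1r // exprS IHf
    -scalerAr XX scalerA exprSr.
have : t ^+ e * t = 0.
  transitivity (\tr (X ^+ e.+1)); last by rewrite exprS Xe mulr0 mxtrace0.
  rewrite Xpow mxtraceZ; congr (_ * _).
  by rewrite /mxtrace big_ord_recl big_ord1; congr (_ + X _ _); apply/val_inj.
by rewrite -exprSr => /eqP; rewrite expf_eq0 => /andP[_ /eqP].
Qed.

Lemma polymap_inverse_injective (K : fieldType) (n : nat) (F : polymap K n) :
  has_polynomial_inverse F -> injective (polymap_eval F).
Proof.
case=> G [GF _] a b /(congr1 (polymap_eval G)).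
by rewrite -!polymap_eval_comp GF !polymap_eval_id.
Qed.

Lemma linearly_independent_neq0 (K : fieldType) (n : nat) (F : polymap K n) m :
  linearly_independent F -> tnth F m != 0.
Proof.
move=> indep; apply/eqP => Fm.
have := indep (fun l => (l == m)%:R) _ m; rewrite eqxx => H.
suff /eqP : (1 : K) = 0 by rewrite oner_eq0.
apply: H; rewrite (bigD1 m) //= Fm scaler0 add0r big1 // => l /negPf ->.
by rewrite scale0r.
Qed.

Lemma mcoeff0_comp2 (K : fieldType) (n : nat) (f : {mpoly K[2]}) (u v : {mpoly K[n]}) :
  u@_0 = 0 -> v@_0 = 0 -> (f \mPo [tuple u; v])@_0 = f@_0.
Proof.
move=> u0 v0; rewrite -(@mcoeff0_meval _ _ _ (fun=> 0)) // comp_mpoly_meval.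
apply: mcoeff0_meval => m; rewrite mcoeff0_meval //.
by case: m => [[|[]]] // lt; rewrite (tnth_nth 0).
Qed.

Lemma ord3P (m : 'I_3) : [\/ m = xvar, m = yvar | m = zvar].
Proof.
by case: m => [[|[|[|//]]]] lt; [apply: Or31 | apply: Or32 | apply: Or33];
  apply/val_inj.
Qed.

(** N is the matrix of the gradients of u and v, and C expresses the gradients of
    u, v and h(u,v) through them. *)
Lemma jacobian_nilpotent_system (K : fieldType) (u v : {mpoly K[3]}) (h : {mpoly K[2]}) :
  let t := [tuple u; v] in
  let H : polymap K 3 := [tuple u; v; h \mPo t] in
  polymap_eval H 0 = 0 -> no_linear_part h -> linearly_independent H ->
  nilpotent_mx (jacobian H) ->
  nilpotent_system xvar yvar zvar u v (h \mPo t)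
    (h^`M(ord0) \mPo t) (h^`M(ord_max) \mPo t)
    (h^`M(ord0)^`M(ord0) \mPo t) (h^`M(ord0)^`M(ord_max) \mPo t)
    (h^`M(ord_max)^`M(ord_max) \mPo t).
Proof.
move=> t H H0 hlin indep [e nil].
have Hm0 m : (tnth H m)@_0 = 0.
  have := congr1 (fun a : 'rV[K]_3 => a 0 m) H0; rewrite !mxE.
  by rewrite mcoeff0_meval // => l; rewrite mxE.
have u0 : u@_0 = 0 := Hm0 xvar; have v0 : v@_0 = 0 := Hm0 yvar.
have lin0 a : (h^`M(a) \mPo t)@_0 = 0.
  by rewrite mcoeff0_comp2 // mcoeff_mderiv add0m mnm0E hlin ?mdeg1.
set P := h^`M(ord0) \mPo t; set S := h^`M(ord_max) \mPo t.
pose N : 'M[{mpoly K[3]}]_(2, 3) :=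
  \matrix_(a, m) (if a == ord0 then u else v)^`M(m).
pose C : 'M[{mpoly K[3]}]_(3, 2) :=
  \matrix_(m, a) (if m == zvar then (if a == ord0 then P else S)
    else ((m == xvar) == (a == ord0))%:R).
have JE : jacobian H = C *m N.
  apply/matrixP => m l; rewrite !mxE big_ord_recl big_ord1 !mxE /=.
  case: (ord3P m) => -> /=; rewrite ?mul1r ?mul0r ?addr0 ?add0r //.
  exact: mderiv_comp2.
have [] := @nilpotent_mx2 _ (N *m C).
  by exists e.+1; rewrite exprS_mulmx_swap -JE nil mulmx0 mul0mx.
rewrite !mxE !big_ord_recl !big_ord0 !mxE /=.
have -> : lift ord0 ord0 = yvar by apply/val_inj.
have -> : lift ord0 (lift ord0 ord0) = zvar by apply/val_inj.
have -> : ord0 = xvar by apply/val_inj.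
rewrite /= !(mulr1, mulr0, addr0, add0r) ![_ * P]mulrC ![_ * S]mulrC => tr det.
split.
- exact: ord3P.
- by [].
- by [].
- by [].
- exact: tr.
- exact: det.
- exact: mderiv_comp2.
- exact: mderiv_comp2.
- by move=> m; rewrite mderiv_comp2 mderiv_comm.
- exact: u0.
- exact: v0.
- exact: (Hm0 zvar).
- exact: lin0.
- exact: lin0.
- exact: (linearly_independent_neq0 xvar indep).
- exact: (linearly_independent_neq0 yvar indep).
- exact: (linearly_independent_neq0 zvar indep).
Qed.

(** * Invertibility *)

Lemma planar_system_invertible (K : fieldType) (n : nat) (charK0 : [pchar K] =i pred0)
    (i j k : 'I_n) (u v w P S Q11 Q12 Q22 : {mpoly K[n]}) (lambda : K) (F : polymap K n) :
  nilpotent_system i j k u v w P S Q11 Q12 Q22 ->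
  u^`M(k) = 0 -> v^`M(k) != 0 -> lambda != 0 ->
  tnth F i = lambda *: 'X_i + u -> tnth F j = lambda *: 'X_j + v ->
  tnth F k = lambda *: 'X_k + w -> has_polynomial_inverse F.
Proof.
move=> sys uk vk l0 Fi Fj Fk.
have [c [kappa [t0 [c0 ui vE wE]]]] := planar_normal_form charK0 sys uk vk.
have two0 : (2%:R : K) != 0 by rewrite (proj1 (pcharf0P K) charK0).
have kE : 2%:R * (kappa / 2%:R)%:MP = kappa%:MP :> {mpoly K[n]}.
  by rewrite -mpolyC_nat -mpolyCM mulrC divfK.
apply: (@normal_form_invertible _ _ i j k (sys_vars sys) (sys_ij sys) (sys_ik sys)
  (sys_jk sys) charK0 F u lambda c (kappa / 2%:R) (kappa / (2%:R * c)) t0) => //.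
- by field; rewrite c0 two0.
- by rewrite kE.
- by rewrite kE Fj vE.
- by rewrite Fk wE.
Qed.

Theorem theorem2p2 (K : fieldType) (charK0 : [pchar K] =i pred0)
    (u v : {mpoly K[3]}) (h : {mpoly K[2]}) :
  let H : polymap K 3 := [tuple u; v; h \mPo [tuple u; v]] in
  let A := v^`M(xvar) * u^`M(zvar) - u^`M(xvar) * v^`M(zvar) in
  let B := v^`M(yvar) * u^`M(zvar) - u^`M(yvar) * v^`M(zvar) in
  polymap_eval H 0 = 0 ->
  no_linear_part h ->
  linearly_independent H ->
  nilpotent_mx (jacobian H) ->
  deg_in zvar (u * A) <> deg_in zvar (v * B) ->
  forall lambda : K, lambda != 0 ->
    injective (polymap_eval (shift_id lambda H)) /\
    has_polynomial_inverse (shift_id lambda H).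
Proof.
move=> H A B H0 hlin indep nil deg_neq lambda l0.
suff inv : has_polynomial_inverse (shift_id lambda H).
  by split=> //; apply: polymap_inverse_injective.
have sys := jacobian_nilpotent_system H0 hlin indep nil.
have sys' := nilpotent_system_swap sys.
have Fm m : tnth (shift_id lambda H) m = lambda *: 'X_m + tnth H m.
  by rewrite tnth_mktuple.
have size_neq : vsize zvar (u * A) <> vsize zvar (v * B).
  by move=> E; apply: deg_neq; rewrite !deg_inE -!(vsize_eq0 zvar) E.
have [uk|uk] := eqVneq (u^`M(zvar)) 0.
  have vk : v^`M(zvar) != 0.
    apply: contra_not_neq size_neq => vk.
    by rewrite /A /B uk vk !mulr0 !subr0 !mulr0.
  exact: (planar_system_invertible charK0 sys uk vk l0 (Fm xvar) (Fm yvar) (Fm zvar)).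
have [vk|vk] := eqVneq (v^`M(zvar)) 0.
  exact: (planar_system_invertible charK0 sys' vk uk l0 (Fm yvar) (Fm xvar) (Fm zvar)).
case: (ltngtP (vsize zvar (u * A)) (vsize zvar (v * B))) => [lt|lt|/size_neq//].
  by case: (asymmetric_system_absurd charK0 sys uk vk lt).
case: (asymmetric_system_absurd charK0 sys' vk uk).
have -> : u^`M(yvar) * v^`M(zvar) - v^`M(yvar) * u^`M(zvar) = - B by rewrite opprB.
have -> : u^`M(xvar) * v^`M(zvar) - v^`M(xvar) * u^`M(zvar) = - A by rewrite opprB.
by rewrite !mulrN !vsizeN.
Qed.
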